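(* Let $\mathbb{K}$ be a field, let $\mathbf{m}=(m_1,\dots,m_n)$ be a nonzero sequence of nonnegative integers with $m_n=0$, and define $p=\max\{j\in\{1,\dots,n\}:m_j\neq0\}$. Let $\Delta=\mathfrak{I}(\mathbf{m})$ be the corresponding intersection complex and let $\beta=\beta(I_{\Delta^*})$, which is a pure Betti diagram with nonzero Betti numbers $\beta_{0,c_0},\dots,\beta_{p,c_p}$. Then $$\beta_{i,c_i}=\begin{cases}\binom{n}{i+1} & \text{if } 0\le i\le p-1,\\[2pt] \binom{n-1}{p} & \text{if } i=p.\end{cases}$$
   Context: Intersection complexes: for a sequence $\mathbf{m}=(m_1,\dots,m_n)$ of nonnegative integers, $\mathfrak{I}(\mathbf{m})$ is the simplicial complex whose vertices are all symbols $v_S^r$ where $S$ is a nonempty subset of $[n]=\{1,\dots,n\}$ and $1\le r\le m_{|S|}$, and whose faces are all subsets of the sets $F_1,\dots,F_n$, where $F_j=\{v_S^r: S\subseteq[n],\ j\in S,\ 1\le r\le m_{|S|}\}$. For a simplicial complex $\Delta$ on a finite vertex set $V$, its Alexander dual is $\Delta^*=\{F\subseteq V:V\setminus F\notin\Delta\}$. In the standard graded polynomial ring $R=\mathbb{K}[x_v:v\in V]$, the Stanley-Reisner ideal of $\Delta^*$ is $I_{\Delta^*}=\langle\prod_{v\in\sigma}x_v:\sigma\subseteq V,\ V\setminus\sigma\in\Delta\rangle$. The graded Betti numbers $\beta_{i,d}(I_{\Delta^*})$ are the exponents in the minimal graded free resolution of $I_{\Delta^*}$ as an $R$-module; $\beta(I_{\Delta^*})$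 is pure if for every $i$ there is at most one $c$ with $\beta_{i,c}\ne0$. *)

(* Defs.v *)
From HB Require Import structures.
From mathcomp Require Import all_boot all_order all_algebra.
From mathcomp Require Import mpoly.

Set Implicit Arguments.
Unset Strict Implicit.
Unset Printing Implicit Defensive.

Import GRing.Theory.
Local Open Scope ring_scope.

(* A simplicial complex on a finite vertex set V is given by its set of faces. *)

Definition alexander_dual (V : finType) (D : {set {set V}}) : {set {set V}} :=
  [set F | ~: F \notin D].

(* K[x_v : v in V] is {mpoly K[#|V|]}, with x_v the variable of index
   enum_rank v. *)
Definition face_monomial (K : fieldType) (V : finType) (s : {set V}) :
    {mpoly K[#|V|]} :=
  \prod_(v in s) 'X_(enum_rank v).

(* For D := alexander_dual D', the indexing condition s \notin D says
   ~: s \in D'. *)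
Definition stanley_reisner_ideal (K : fieldType) (V : finType)
    (D : {set {set V}}) (f : {mpoly K[#|V|]}) : Prop :=
  exists a : {set V} -> {mpoly K[#|V|]},
    f = \sum_(s : {set V} | s \notin D) a s * face_monomial K s.

(* Data of a complex ... -> F_2 -> F_1 -> F_0 -> R of graded free modules over
   R = K[x_0, ..., x_(N-1)], where F_i has a finite basis whose k-th element
   has degree gf_deg i k.  Elements of F_i are row vectors and maps act by
   right multiplication.  Since an ideal of R lives in nonnegative degrees, so
   do the basis elements of its minimal resolutions: natural number degrees
   suffice. *)
Record graded_free_data (K : fieldType) (N : nat) := GradedFreeData {
  gf_rank : nat -> nat;
  gf_deg : forall i, 'I_(gf_rank i) -> nat;
  gf_diff : forall i, 'M[{mpoly K[N]}]_(gf_rank i.+1, gf_rank i);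
  gf_aug : 'cV[{mpoly K[N]}]_(gf_rank 0)
}.

(* f is homogeneous of degree d - e; in particular f = 0 when d < e. *)
Definition homog_diff (K : fieldType) (N : nat) (d e : nat) (f : {mpoly K[N]}) :
    bool :=
  if (e <= d)%N then f \is (d - e)%N.-homog else f == 0.

Definition degree_preserving (K : fieldType) (N : nat)
    (F : graded_free_data K N) : Prop :=
  (forall k, gf_aug F k 0 \is (gf_deg k).-homog) /\
  (forall i k l, homog_diff (gf_deg k) (gf_deg l) (gf_diff F i k l)).

Definition resolves (K : fieldType) (N : nat) (I : {mpoly K[N]} -> Prop)
    (F : graded_free_data K N) : Prop :=
  [/\ (forall f, I f <-> exists u : 'rV_(gf_rank F 0), u *m gf_aug F = f%:M),
      (forall u : 'rV_(gf_rank F 0),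
         u *m gf_aug F = 0 <-> exists w, u = w *m gf_diff F 0)
    & (forall i (u : 'rV_(gf_rank F i.+1)),
         u *m gf_diff F i = 0 <-> exists w, u = w *m gf_diff F i.+1)].

(* The differentials map F_(i+1) into <x_0, ..., x_(N-1)> F_i. *)
Definition minimal (K : fieldType) (N : nat) (F : graded_free_data K N) : Prop :=
  forall i k l, (gf_diff F i k l)@_0%MM = 0.

Definition minimal_graded_free_resolution (K : fieldType) (N : nat)
    (I : {mpoly K[N]} -> Prop) (F : graded_free_data K N) : Prop :=
  [/\ degree_preserving F, resolves I F & minimal F].

(* beta = beta(I): beta i d is the exponent of R(-d) in the i-th module of a
   minimal graded free resolution of I. *)
Definition is_betti_diagram (K : fieldType) (N : nat)
    (I : {mpoly K[N]} -> Prop) (beta : nat -> nat -> nat) : Prop :=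
  exists2 F : graded_free_data K N, minimal_graded_free_resolution I F
    & forall i d, beta i d = #|[set k : 'I_(gf_rank F i) | gf_deg k == d]|.

Definition pure (beta : nat -> nat -> nat) : Prop :=
  forall i c c', beta i c != 0%N -> beta i c' != 0%N -> c = c'.

(* m = (m_1, ..., m_n) is a tuple indexed from 0; mult m k is m_k for
   1 <= k <= n, and mult m 0 = 0. *)
Definition mult (n : nat) (m : n.-tuple nat) (k : nat) : nat :=
  nth 0%N (0%N :: m) k.

(* The vertex v_S^r is Tagged _ r with tag S and r shifted to start from 0.
   There is none with S = set0, since mult m 0 = 0. *)
Definition ivertex (n : nat) (m : n.-tuple nat) : finType :=
  {S : {set 'I_n} & 'I_(mult m #|S|)}.

Definition ifacet (n : nat) (m : n.-tuple nat) (j : 'I_n) : {set ivertex m} :=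
  [set v : ivertex m | j \in tag v].

Definition intersection_complex (n : nat) (m : n.-tuple nat) :
    {set {set ivertex m}} :=
  [set G : {set ivertex m} | [exists j : 'I_n, G \subset ifacet m j]].

Definition last_nonzero (n : nat) (m : n.-tuple nat) : nat :=
  \max_(1 <= j < n.+1 | mult m j != 0%N) j.

(* Main.v *)
Require Import Defs.
From HB Require Import structures.
From mathcomp Require Import all_boot all_order all_algebra.
From mathcomp Require Import mpoly.

Set Implicit Arguments.
Unset Strict Implicit.
Unset Printing Implicit Defensive.

(* The ideal is generated by the monomials L_{j}, where L_T is the product of
   the variables x_v whose tag does not contain T.  Truncating the Taylor
   complex of these generators gives a minimal resolution: it has a basis
   element e_T of degree deg L_T for every T with 1 <= #|T| <= p, and for every
   T with #|T| = p + 1 that contains a fixed index j0.  For exactness, multiply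
   the coefficient of e_T by L_T: the differential becomes the simplicial
   boundary, and the part of the complex in the multidegree of a monomial a is
   the complex of a (truncated) full simplex on the set of j common to all tags
   of variables absent from a.  That simplex is contracted by coning with one
   of its vertices; choosing the vertex j0 whenever possible respects the
   truncation in top degree.  Two minimal resolutions are compared by lifting
   the identity in a degree-preserving way; the constant parts of the
   comparison maps are mutually inverse, so the Betti numbers agree. *)

Import GRing.Theory.

(** * Graded matrices over a polynomial ring and their constant parts *)

Section GradedMatrices.
Local Open Scope ring_scope.
Variables (K : fieldType) (N : nat).
Local Notation R := {mpoly K[N]}.

Definition graded_mx r s (a : 'I_r -> nat) (b : 'I_s -> nat) (M : 'M[R]_(r, s)) :=
  forall k l, homog_diff (a k) (b l) (M k l).

Definition constant_part r s (M : 'M[R]_(r, s)) : 'M[K]_(r, s) :=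
  map_mx (mcoeff 0%MM) M.

Lemma constant_partM r s t (A : 'M[R]_(r, s)) (B : 'M[R]_(s, t)) :
  constant_part (A *m B) = constant_part A *m constant_part B.
Proof. exact: map_mxM. Qed.

Lemma homog_diff_mcoeff0 d e (f : R) :
  homog_diff d e f -> d != e -> f@_0 = 0.
Proof.
rewrite /homog_diff; case: leqP => [led hf ned | _ /eqP ->]; last by rewrite mcoeff0.
apply: (dhomog_nemf_coeff hf).
by rewrite -[X in X != _]/(mdeg 0%MM) mdeg0 eq_sym subn_eq0 -ltnNge ltn_neqAle eq_sym ned.
Qed.

(** Only the component of [p] of degree [mdeg m - d] can contribute to this coefficient; the guard
    excludes truncated subtraction. *)
Lemma mcoeffM_homog d (p q : R) m : q \is d.-homog ->
  (p * q)@_m = ((if (d <= mdeg m)%N then pihomog mdeg (mdeg m - d) p else 0) * q)@_m.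
Proof.
move=> hq; rewrite {1}[p](@pihomog_partitionE _ _ mdeg (msize p)) // mulr_suml.
rewrite raddf_sum /=.
have z (k : nat) : (k + d)%N != mdeg m -> (pihomog mdeg k p * q)@_m = 0.
  move=> ne; apply: (@dhomog_nemf_coeff _ _ mdeg (k + d)); last by rewrite eq_sym.
  by apply: dhomogM; rewrite // pihomogP.
case: leqP => led; last first.
  rewrite mul0r mcoeff0 big1 // => k _; apply: z.
  by apply: contraTneq led => <-; rewrite -leqNgt leq_addl.
case: (ltnP (mdeg m - d) (msize p)) => ltk.
  rewrite (bigD1 (Ordinal ltk)) //= big1 ?addr0 // => k nek; apply: z.
  by apply: contraNneq nek => E; rewrite -val_eqE /= -E addnK.
rewrite big1 => [|k _]; last first.
  apply: z; apply: contraTneq (ltn_ord k) => E.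
  by rewrite -leqNgt -E addnK in ltk *.
rewrite [pihomog _ _ p](_ : _ = 0) ?mul0r ?mcoeff0 //.
rewrite pihomogE big_seq_cond big_pred0 // => m'; apply/andP => -[m'p /eqP E].
by have := msize_mdeg_lt m'p; rewrite E ltnNge ltk.
Qed.

(** Keep in each entry of [U] only the component of degree [a k - b l]. The discarded components
    cannot affect the product, because [A] and [B] are graded. *)
Lemma graded_lift r s t (a : 'I_r -> nat) (b : 'I_s -> nat) (c : 'I_t -> nat)
    (A : 'M[R]_(r, t)) (B : 'M[R]_(s, t)) (U : 'M[R]_(r, s)) :
  graded_mx a c A -> graded_mx b c B -> A = U *m B ->
  exists2 V, graded_mx a b V & A = V *m B.
Proof.
move=> gA gB AE.
exists (\matrix_(k, l) if (b l <= a k)%N then pihomog mdeg (a k - b l) (U k l) else 0).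
  move=> k l; rewrite /homog_diff mxE; case: leqP => // _; exact: pihomogP.
apply/matrixP => k l; rewrite [RHS]mxE; apply/mpolyP => m.
have := gA k l; have := AE; move/matrixP/(_ k l); rewrite /homog_diff => E.
case: (boolP ((c l <= a k)%N && (mdeg m == a k - c l)%N)) => [/andP[lec /eqP mE] _ | neg hA].
  rewrite E mxE !raddf_sum /=; apply: eq_bigr => i _; rewrite !mxE.
  have := gB i l; rewrite /homog_diff; case: (leqP (c l) (b i)) => [leb hB|_ /eqP->];
    last by rewrite !mulr0.
  rewrite (mcoeffM_homog _ _ hB) mE.
  rewrite -(leq_add2r (c l)) !subnK //; case: leqP => // leab.
  by rewrite -subnDA addnC subnK // subnBA // subnK.
have -> : (A k l)@_m = 0.
  case: leqP neg hA => [_ ne hA|_ _ /eqP ->]; last by rewrite mcoeff0.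
  exact: dhomog_nemf_coeff hA _.
rewrite raddf_sum /= big1 // => i _; rewrite mxE.
case: leqP => [leb|_]; last by rewrite mul0r mcoeff0.
have := gB i l; rewrite /homog_diff; case: (leqP (c l) (b i)) => [lec hB|_ /eqP->];
    last by rewrite mulr0 mcoeff0.
have h := dhomogM (pihomogP mdeg (a k - b i) (U k i)) hB.
apply: (dhomog_nemf_coeff h); apply: contraNneq neg => ->.
by rewrite (leq_trans lec leb) addnBA // subnK //=.
Qed.

Lemma rows_lift r s t (A : 'M[R]_(r, t)) (B : 'M[R]_(s, t)) :
  (forall k, exists w : 'rV_s, row k A = w *m B) -> exists U, A = U *m B.
Proof.
move=> /fin_all_exists[f fE]; exists (\matrix_k f k).
by apply/row_matrixP => k; rewrite fE row_mul rowK.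
Qed.

Lemma exact_lift r s t u (A : 'M[R]_(r, t)) (B : 'M[R]_(s, t)) (D : 'M[R]_(t, u)) :
  (forall v : 'rV_t, v *m D = 0 <-> exists w, v = w *m B) ->
  A *m D = 0 -> exists U, A = U *m B.
Proof.
move=> ex AD; apply: rows_lift => k; apply/ex.
by rewrite -row_mul AD row0.
Qed.

Lemma exact_mul0 s t u (B : 'M[R]_(s, t)) (D : 'M[R]_(t, u)) :
  (forall v : 'rV_t, v *m D = 0 <-> exists w, v = w *m B) -> B *m D = 0.
Proof.
move=> ex; apply/row_matrixP => k; rewrite row_mul row0; apply/ex.
by exists (delta_mx 0 k); rewrite rowE.
Qed.

(** A graded matrix has zero constant entries between different degrees, so the identity on the rows
    of degree [d] factors through the columns of degree [d]; comparing ranks gives the bound. *)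
Lemma leq_card_degree r s (a : 'I_r -> nat) (b : 'I_s -> nat)
    (A : 'M[R]_(r, s)) (B : 'M[R]_(s, r)) d :
  graded_mx a b A -> constant_part A *m constant_part B = 1%:M ->
  (#|[set k | a k == d]| <= #|[set l | b l == d]|)%N.
Proof.
move=> gA AB1; set S := [set k | _]; set T := [set l | _].
pose f (k : 'I_#|S|) := enum_val k; pose g (l : 'I_#|T|) := enum_val l.
apply: (@mulmx1_min _ _ _ (mxsub f g (constant_part A)) (mxsub g f (constant_part B))).
apply/matrixP => i j; have /matrixP/(_ (f i) (f j)) := AB1; rewrite !mxE.
rewrite (inj_eq enum_val_inj) => <-.
rewrite [RHS](bigID (mem T)) /= [X in _ + X]big1 ?addr0.
  rewrite [RHS]big_enum_val /=; apply: eq_bigr => l _; by rewrite !mxE.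
move=> l lT; rewrite !mxE (homog_diff_mcoeff0 (gA _ _)) ?mul0r //.
by have := enum_valP i; rewrite !inE in lT * => /eqP ->; rewrite eq_sym.
Qed.

End GradedMatrices.

(** * Uniqueness of the graded ranks of a minimal resolution *)

Section Uniqueness.
Local Open Scope ring_scope.
Variables (K : fieldType) (N : nat) (I : {mpoly K[N]} -> Prop).
Variables (F G : graded_free_data K N).
Hypotheses (resF : minimal_graded_free_resolution I F)
  (resG : minimal_graded_free_resolution I G).

Lemma ideal_lift (H H' : graded_free_data K N) :
  minimal_graded_free_resolution I H -> minimal_graded_free_resolution I H' ->
  exists2 V, graded_mx (@gf_deg _ _ H 0) (@gf_deg _ _ H' 0) V &
    gf_aug H = V *m gf_aug H'.
Proof.
move=> [[ga _] [aI _ _] _] [[ga' _] [aI' _ _] _].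
have [U UE] : exists U, gf_aug H = U *m gf_aug H'.
  apply: rows_lift => k; have /aI'[w wE] : I (gf_aug H k 0).
    apply/aI; exists (delta_mx 0 k); rewrite -rowE; apply/matrixP => i j.
    by rewrite !ord1 !mxE.
  exists w; rewrite wE; apply/matrixP => i j; by rewrite !ord1 !mxE.
have g0 (H0 : graded_free_data K N) : (forall k, gf_aug H0 k 0 \is (gf_deg k).-homog) ->
    graded_mx (@gf_deg _ _ H0 0) (fun=> 0%N) (gf_aug H0).
  by move=> g k l; rewrite (ord1 l) /homog_diff subn0; exact: g.
exact: graded_lift (g0 _ ga) (g0 _ ga') UE.
Qed.

(* The levelwise data of comparison maps F -> G -> F and of a homotopy from
   their composite to the identity.  The product of the constant parts is 1
   because minimality kills the constant part of the homotopy terms. *)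
Lemma comparison i : exists (P : 'M_(gf_rank F i, gf_rank G i)) Q h,
  [/\ graded_mx (@gf_deg _ _ F i) (@gf_deg _ _ G i) P,
      graded_mx (@gf_deg _ _ G i) (@gf_deg _ _ F i) Q,
      (exists A, gf_diff F i *m P = A *m gf_diff G i)
        /\ (exists B, gf_diff G i *m Q = B *m gf_diff F i),
      gf_diff F i *m (P *m Q - 1%:M) = gf_diff F i *m h *m gf_diff F i &
      constant_part P *m constant_part Q = 1%:M].
Proof.
have cst j (p q : nat) (h1 : 'M_(p, gf_rank F j.+1)) (h2 : 'M_(gf_rank F j, q)) :
    constant_part (h1 *m gf_diff F j) = 0 /\ constant_part (gf_diff F j *m h2) = 0.
  case: resF => _ _ mF; have z : constant_part (gf_diff F j) = 0.
    by apply/matrixP => k l; rewrite !mxE mF.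
  by rewrite !constant_partM z mulmx0 mul0mx.
have cst1 (p q : nat) (P : 'M_(p, q)) Q (Z : 'M[{mpoly K[N]}]_p) :
    P *m Q - 1%:M = Z -> constant_part Z = 0 ->
    constant_part P *m constant_part Q = 1%:M.
  move=> /eqP; rewrite subr_eq => /eqP E Z0.
  by rewrite -constant_partM E /constant_part map_mxD map_mx1 -/(constant_part Z) Z0 add0r.
elim: i => [|i [P [Q [h [gP gQ [[A AE] [B BE]] hE c1]]]]].
  have [P gP PE] := ideal_lift resF resG; have [Q gQ QE] := ideal_lift resG resF.
  case: resF => _ [_ exF _] _; case: resG => _ [_ exG _] _.
  have [h hE] : exists h, P *m Q - 1%:M = h *m gf_diff F 0.
    by apply: (exact_lift exF); rewrite mulmxBl mul1mx -mulmxA -QE -PE subrr.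
  exists P, Q, h; split => //.
  - by split; [apply: (exact_lift exG) | apply: (exact_lift exF)];
      rewrite -mulmxA -?PE -?QE exact_mul0.
  - by rewrite hE mulmxA.
  - by apply: (cst1 _ _ _ _ _ hE); case: (cst 0%N _ 0%N h 0).
case: (resF) (resG) => [[_ gF] [_ _ exF] _] [[_ gG] [_ _ exG] _].
have gcomp (a b c : nat) (da : 'I_a -> nat) (db : 'I_b -> nat) (dc : 'I_c -> nat)
    (X : 'M[{mpoly K[N]}]_(a, b)) (Y : 'M_(b, c)) :
    graded_mx da db X -> graded_mx db dc Y -> graded_mx da dc (X *m Y).
  move=> gX gY k l; rewrite /homog_diff mxE; case: leqP => lec.
    apply: rpred_sum => j _; have := gX k j; have := gY j l; rewrite /homog_diff.
    case: leqP => [le1|_ /eqP->]; last by rewrite mulr0 rpred0.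
    case: leqP => [le2 h1 h2|_ _ /eqP->]; last by rewrite mul0r rpred0.
    have := dhomogM h2 h1; by rewrite addnBA // subnK.
  apply/eqP; rewrite big1 // => j _; have := gX k j; have := gY j l; rewrite /homog_diff.
  case: leqP => [le1|_ /eqP->]; last by rewrite mulr0.
  case: leqP => [le2|_ _ /eqP->]; last by rewrite mul0r.
  by have := leq_trans le1 le2; rewrite leqNgt lec.
have [P' gP' PE] := graded_lift (gcomp _ _ _ _ _ _ _ _ (gF i) gP) (gG i) AE.
have [Q' gQ' QE] := graded_lift (gcomp _ _ _ _ _ _ _ _ (gG i) gQ) (gF i) BE.
have dF := exact_mul0 (exF i); have dG := exact_mul0 (exG i).
have [h' h'E] : exists h', P' *m Q' - 1%:M - gf_diff F i *m h = h' *m gf_diff F i.+1.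
  apply: (exact_lift (exF i)); rewrite !mulmxBl -hE -mulmxA -QE mulmxA -PE -mulmxA.
  by rewrite mul1mx mulmxBr mulmx1 subrr.
have E : P' *m Q' - 1%:M = h' *m gf_diff F i.+1 + gf_diff F i *m h.
  by rewrite -h'E subrK.
exists P', Q', h'; split => //.
- split; [apply: (exact_lift (exG i)) | apply: (exact_lift (exF i))];
    by rewrite -mulmxA -?PE -?QE mulmxA ?dF ?dG mul0mx.
(* Premultiplying by the differential removes the term in [h]; the invariant has this form so that
   it mentions only the newest homotopy. *)
- by rewrite E mulmxDr !mulmxA dF mul0mx addr0.
- apply: (cst1 _ _ _ _ _ E); rewrite /constant_part map_mxD.
  have [z1 _] := cst i.+1 _ 0%N h' 0; have [_ z2] := cst i 0%N _ 0 h.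
  by rewrite -!/(constant_part _) z1 z2 addr0.
Qed.

Lemma minimal_resolution_leq i d :
  (#|[set k | @gf_deg _ _ F i k == d]| <= #|[set k | @gf_deg _ _ G i k == d]|)%N.
Proof.
have [P [Q [h [gP _ _ _ c1]]]] := comparison i.
exact: leq_card_degree gP c1.
Qed.

End Uniqueness.

Lemma betti_unique (K : fieldType) (N : nat) (I : {mpoly K[N]} -> Prop) beta beta' :
  is_betti_diagram I beta -> is_betti_diagram I beta' ->
  forall i d, beta i d = beta' i d.
Proof.
move=> [F rF bF] [G rG bG] i d; rewrite bF bG; apply/eqP.
by rewrite eqn_leq !(@minimal_resolution_leq _ _ I).
Qed.

(** * The augmented chain complex of a full simplex and its cone homotopy *)

Section Simplex.
Local Open Scope ring_scope.
Variables (K : comNzRingType) (V : lmodType K) (n : nat).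
Implicit Types (T : {set 'I_n}) (j k : 'I_n) (w : {set 'I_n} -> V).

Definition incidence_sign k T : K := (-1) ^+ #|[set l in T | (l < k)%N]|.

(** A chain is encoded by its coefficients, so the value at [T] collects those of the faces having
    [T] as a facet. Allowing [T = set0] makes the complex augmented. *)
Definition boundary w T : V := \sum_(k | k \notin T) incidence_sign k T *: w (k |: T).

(** On basis faces, this sends a face avoiding [j] to its signed join with [j] and kills the faces
    containing [j]. *)
Definition cone j w T : V := if j \in T then incidence_sign j T *: w (T :\ j) else 0.

Lemma incidence_signU k l T : l \notin T ->
  incidence_sign k (l |: T) = (-1) ^+ (l < k)%N * incidence_sign k T.
Proof.
move=> lT; rewrite /incidence_sign.
have -> : [set i in l |: T | (i < k)%N] =
    (if (l < k)%N then [set l] else set0) :|: [set i in T | (i < k)%N].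
  apply/setP => i; rewrite !inE; case: ifP => lk; rewrite !inE.
    by case: eqP => // ->; rewrite lk.
  by case: eqP => //= ->; rewrite lk (negPf lT).
case: ifP => lk; last by rewrite set0U mul1r.
by rewrite cardsU1 inE (negPf lT) exprD.
Qed.

Lemma incidence_sign_sq k T : incidence_sign k T * incidence_sign k T = 1.
Proof. by rewrite -expr2 sqrr_sign. Qed.

Lemma incidence_sign_swap k l T : k != l -> k \notin T -> l \notin T ->
  incidence_sign k (l |: T) * incidence_sign l T =
  - (incidence_sign l (k |: T) * incidence_sign k T).
Proof.
move=> kl kT lT; rewrite !incidence_signU //.
have : (l < k)%N = ~~ (k < l)%N by rewrite -leqNgt ltn_neqAle eq_sym kl.
move=> ->; case: (k < l)%N => /=; rewrite ?expr0 ?expr1 !mulNr ?mul1r ?opprK //.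
  by rewrite mulrC.
by rewrite [in RHS]mulrC.
Qed.

Lemma boundary_boundary w T : boundary (boundary w) T = 0.
Proof.
rewrite /boundary.
under eq_bigr => k kT do rewrite scaler_sumr.
rewrite pair_big_dep (bigID (fun p : 'I_n * 'I_n => (p.1 < p.2)%N)) /=.
apply/eqP; rewrite addr_eq0; apply/eqP.
rewrite (reindex_inj (inv_inj (@swap_pairK _ _))) -sumrN /=.
apply: eq_big => [[k l] /=|[k l] /=]; rewrite !in_setU1 !negb_or.
  rewrite -!val_eqE /=; case: ltngtP => kl; rewrite ?andbF ?andbT //=.
  by rewrite andbC.
move=> /andP[/and3P[lT kl kT] _]; rewrite setUCA !scalerA -scaleNr; congr (_ *: _).
rewrite (mulrC (incidence_sign l T)) (mulrC (incidence_sign k T)).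
exact: incidence_sign_swap.
Qed.

(** If [j] is not in [T], only the term [k = j] of the first summand survives. If [j] is in [T], the
    term [k = j] of the second summand gives [w T] and its other terms cancel against the first. *)
Lemma boundary_cone j w T : boundary (cone j w) T + cone j (boundary w) T = w T.
Proof.
rewrite /cone; case: ifPn => jT; last first.
  rewrite addr0 /boundary (bigD1 j) //= big1 ?addr0.
    rewrite setU11 setU1K // scalerA incidence_signU // ltnn mul1r.
    by rewrite incidence_sign_sq scale1r.
  move=> k /andP[kT kj]; rewrite in_setU1 eq_sym (negPf kj) (negPf jT) scaler0.
  by [].
rewrite [boundary w _](bigD1 j) ?setD11 //= setD1K // scalerDr addrCA.
set x := (X in X + _); have -> : x = w T.
  rewrite /x scalerA -{1}(setD1K jT) incidence_signU ?setD11 // ltnn mul1r.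
  by rewrite incidence_sign_sq scale1r.
rewrite -[RHS]addr0; congr (_ + _).
rewrite /boundary scaler_sumr [X in _ + X](eq_bigl (fun k => k \notin T)); last first.
  move=> k; rewrite in_setD1 negb_and negbK; by case: eqP => [->|_]; rewrite ?jT ?andbF ?andbT.
rewrite -big_split /= big1 // => k kT.
have kj : k != j by apply: contraNneq kT => ->.
rewrite in_setU1 jT orbT !scalerA.
have -> : (k |: T) :\ j = k |: (T :\ j).
  apply/setP => i; rewrite !inE; case: (i =P j) => //= ->; by rewrite eq_sym (negPf kj).
rewrite -scalerDl (incidence_signU j kT) -{1}(setD1K jT) incidence_signU ?setD11 //.
have : (j < k)%N = ~~ (k < j)%N.
  by rewrite -leqNgt ltn_neqAle eq_sym -(inj_eq val_inj) in kj *; rewrite kj.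
move=> ->; have -> : incidence_sign j T * incidence_sign k (T :\ j) =
    incidence_sign k (T :\ j) * incidence_sign j T by rewrite mulrC.
by case: (k < j)%N => /=; rewrite ?expr0 ?expr1 ?mulN1r ?mul1r ?mulrN ?mulNr addNr scale0r.
Qed.

End Simplex.

(** * Squarefree monomials and supports of polynomials *)

Section SquarefreeMonomials.
Local Open Scope ring_scope.
Variables (K : fieldType) (V : finType).
Local Notation R := {mpoly K[#|V|]}.
Implicit Types (s : {set V}) (f : R) (a : 'X_{1..#|V|}).

Definition set_mnm s : 'X_{1..#|V|} := [multinom (enum_val i \in s : nat) | i < #|V|].

Lemma face_monomialE s : face_monomial K s = 'X_[set_mnm s].
Proof.
rewrite mpolyXE_id /face_monomial big_mkcond /= (reindex (@enum_rank V)) /=; last first.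
  by exists enum_val => i _; rewrite ?enum_rankK ?enum_valK.
by apply: eq_bigr => v _; rewrite mnmE enum_rankK; case: (v \in s).
Qed.

Lemma face_monomial_neq0 s : face_monomial K s != 0.
Proof.
rewrite face_monomialE; apply/eqP => /(congr1 (mcoeff (set_mnm s))).
by rewrite mcoeffX eqxx mcoeff0 => /eqP; rewrite oner_eq0.
Qed.

Lemma face_monomial_homog s : face_monomial K s \is #|s|.-homog.
Proof.
rewrite face_monomialE dhomogX /= -[X in X == _]/(mdeg (set_mnm s)) mdegE.
rewrite -[#|s|]sum1_card [X in _ == X]big_mkcond /=.
rewrite [X in X == _](reindex (@enum_rank V)) /=; last first.
  by exists enum_val => i _; rewrite ?enum_rankK ?enum_valK.
by apply/eqP; apply: eq_bigr => v _; rewrite mnmE enum_rankK; case: (v \in s).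
Qed.

Lemma face_monomialD s1 s2 : s1 \subset s2 ->
  face_monomial K s2 = face_monomial K (s2 :\: s1) * face_monomial K s1.
Proof.
by move=> s12; rewrite /face_monomial (big_setID s1) /= (setIidPr s12) mulrC.
Qed.

Lemma face_monomial_mcoeff0 s : s != set0 -> (face_monomial K s)@_0%MM = 0.
Proof.
move=> s0; apply: (dhomog_nemf_coeff (face_monomial_homog s)).
by rewrite -[X in X != _]/(mdeg 0%MM) mdeg0 eq_sym cards_eq0.
Qed.

(** Divisibility by a monomial can be tested on each monomial of the support; a squarefree divisor
    only asks for nonzero exponents. *)
Lemma face_monomial_dvdP s f :
  (exists q, f = q * face_monomial K s) <->
  (forall a, a \in msupp f -> forall v, v \in s -> a (enum_rank v) != 0%N).
Proof.
rewrite face_monomialE; split=> [[q ->] a | af].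
  rewrite mcoeff_msupp => ha v vs; apply: contraNneq ha => a0.
  rewrite (mpolyE q) mulr_suml raddf_sum /= big1 // => b _.
  rewrite -scalerAl -mpolyXD mcoeffZ mcoeffX; case: eqP => [E|]; last by rewrite mulr0.
  by have := a0; rewrite -E mnmDE mnmE enum_rankK vs addn1.
exists (\sum_(a <- msupp f) f@_a *: 'X_[(a - set_mnm s)%MM]).
rewrite {1}(mpolyE f) mulr_suml; apply: eq_big_seq => a ha.
rewrite -scalerAl -mpolyXD submK //; apply/mnm_lepP => i; rewrite mnmE.
case: (boolP (_ \in s)) => // vs; by have := af _ ha _ vs; rewrite enum_valK lt0n.
Qed.

(** A selection of multigraded components. It is [K]-linear, which suffices to commute with
    [boundary], whose coefficients are signs. *)
Definition restrict_supp (P : pred 'X_{1..#|V|}) f : R :=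
  \sum_(a <- msupp f | P a) f@_a *: 'X_[a].

Lemma mcoeff_restrict_supp P f a :
  (restrict_supp P f)@_a = if P a then f@_a else 0.
Proof.
rewrite /restrict_supp raddf_sum /= big_mkcond /=.
have z b : b != a -> (f@_b *: 'X_[b])@_a = 0.
  by move=> ba; rewrite mcoeffZ mcoeffX (negPf ba) mulr0.
have [ha | ha] := boolP (a \in msupp f).
  rewrite (bigD1_seq a) ?msupp_uniq //= mcoeffZ mcoeffX eqxx mulr1.
  by rewrite big1 ?addr0 // => b ba; rewrite z // if_same.
rewrite (memN_msupp_eq0 ha) if_same big_seq big1 // => b hb.
by rewrite z ?if_same //; apply: contraNneq ha => <-.
Qed.

Lemma restrict_supp0 P : restrict_supp P 0 = 0.
Proof. by apply/mpolyP => a; rewrite mcoeff_restrict_supp mcoeff0 if_same. Qed.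

Lemma restrict_suppZ P c f : restrict_supp P (c *: f) = c *: restrict_supp P f.
Proof.
by apply/mpolyP => a; rewrite mcoeffZ !mcoeff_restrict_supp mcoeffZ; case: ifP; rewrite ?mulr0.
Qed.

Lemma restrict_supp_sum P (J : finType) (Q : pred J) (F : J -> R) :
  restrict_supp P (\sum_(j | Q j) F j) = \sum_(j | Q j) restrict_supp P (F j).
Proof.
apply/mpolyP => a; rewrite mcoeff_restrict_supp !raddf_sum /=.
under [in RHS]eq_bigr do rewrite mcoeff_restrict_supp.
by case: ifP => // _; rewrite big1.
Qed.

Lemma restrict_supp_partition (J : finType) (h : 'X_{1..#|V|} -> J) f :
  \sum_j restrict_supp (fun a => h a == j) f = f.
Proof.
apply/mpolyP => a; rewrite raddf_sum /= (bigD1 (h a)) //= mcoeff_restrict_supp eqxx.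
by rewrite big1 ?addr0 // => j; rewrite mcoeff_restrict_supp eq_sym => /negPf ->.
Qed.

End SquarefreeMonomials.

(** * The truncated Taylor complex, its exactness and its minimality *)

Section Resolution.
Local Open Scope ring_scope.
Variables (K : fieldType) (V : finType) (n : nat) (t : V -> {set 'I_n}).
Variables (p : nat) (j0 : 'I_n).
Hypothesis p_gt0 : (0 < p)%N.
Hypothesis t_card : forall v, (#|t v| <= p)%N.
Hypothesis t_sep : forall (T : {set 'I_n}) k, (#|T| <= p)%N -> k \notin T ->
  exists2 v, T \subset t v & k \notin t v.
Local Notation R := {mpoly K[#|V|]}.
Implicit Types (T : {set 'I_n}) (j k : 'I_n) (w z : {set 'I_n} -> R).

(** The variables of L_T. This is the union of the sets [missed [set j]] for [j] in [T], so L_T is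
    the least common multiple of the corresponding generators. *)
Definition missed T : {set V} := [set v | ~~ (T \subset t v)].

Lemma missedS T1 T2 : T1 \subset T2 -> missed T1 \subset missed T2.
Proof.
move=> T12; apply/subsetP => v; rewrite !inE; apply: contra; exact: subset_trans.
Qed.

Definition basis_faces i : {set {set 'I_n}} :=
  [set T : {set 'I_n} | (#|T| == i.+1) && ((i < p)%N || (i == p) && (j0 \in T))].

(** Only faces of size [p + 1] are subject to the condition on [j0], and their facets have size [p];
    hence the truncation is a subcomplex. *)
Lemma basis_faces_facet i k T :
  k \notin T -> k |: T \in basis_faces i.+1 -> T \in basis_faces i.
Proof.
rewrite !inE => kT; rewrite cardsU1 kT eqSS => /andP[-> /=].
by case/orP=> [/ltnW -> // | /andP[/eqP <- _]]; rewrite leqnn.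
Qed.

Lemma basis_faces0 T : (T \in basis_faces 0) = (#|T| == 1%N).
Proof. by rewrite inE p_gt0 andbT. Qed.

(** The sum has at most one term, the signed quotient of L_T by L_T', present when [T'] is a facet
    of [T]. *)
Definition diff_coef T T' : R :=
  \sum_(j | (j \notin T') && (j |: T' == T))
    incidence_sign K j T' *: face_monomial K (missed T :\: missed T').

Definition resolution : graded_free_data K #|V| :=
  @GradedFreeData K #|V| (fun i => #|basis_faces i|)
    (fun i b => #|missed (enum_val b)|)
    (fun i => \matrix_(b, c) diff_coef (enum_val b) (enum_val c))
    (\col_b face_monomial K (missed (enum_val b))).

(* The coefficients of u multiplied by the L_T, which turns gf_diff into boundary. *)
Definition chain i (u : 'rV[R]_#|basis_faces i|) T : R :=
  \sum_(b | enum_val b == T) u 0 b * face_monomial K (missed T).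

Lemma chain_enum_val i (u : 'rV[R]_#|basis_faces i|) b :
  chain u (enum_val b) = u 0 b * face_monomial K (missed (enum_val b)).
Proof.
by rewrite /chain (eq_bigl (pred1 b)) ?big_pred1_eq // => l; rewrite (inj_eq enum_val_inj).
Qed.

Lemma chain_out i (u : 'rV[R]_#|basis_faces i|) T : T \notin basis_faces i -> chain u T = 0.
Proof.
move=> TB; rewrite /chain big_pred0 // => k; apply: contraNF TB => /eqP <-.
exact: enum_valP.
Qed.

Lemma chain_inj i (u v : 'rV[R]_#|basis_faces i|) : chain u =1 chain v -> u = v.
Proof.
move=> uv; apply/rowP => k; have := uv (enum_val k); rewrite !chain_enum_val.
exact/mulIf/face_monomial_neq0.
Qed.

Lemma chain_surj i w :
  (forall T, T \notin basis_faces i -> w T = 0) ->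
  (forall T, exists q, w T = q * face_monomial K (missed T)) ->
  exists u : 'rV_#|basis_faces i|, chain u =1 w.
Proof.
move=> w0 /fin_all_exists[q qE]; exists (\row_k q (enum_val k)) => T.
have [TB | TB] := boolP (T \in basis_faces i); last by rewrite chain_out ?w0.
by rewrite -(enum_rankK_in TB TB) chain_enum_val mxE -qE.
Qed.

Lemma chain0 i T : chain (0 : 'rV_#|basis_faces i|) T = 0.
Proof. by rewrite /chain big1 // => k _; rewrite mxE mul0r. Qed.

Lemma boundary_chain i (u : 'rV[R]_#|basis_faces i.+1|) T :
  boundary (chain u) T = chain (u *m gf_diff resolution i) T.
Proof.
have [TB | TB] := boolP (T \in basis_faces i); last first.
  rewrite chain_out // /boundary big1 // => k kT; rewrite chain_out ?scaler0 //.
  by apply: contraNN TB; apply: basis_faces_facet.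
rewrite -[in RHS](enum_rankK_in TB TB) chain_enum_val enum_rankK_in // mxE mulr_suml.
rewrite /boundary /chain; under eq_bigr do rewrite scaler_sumr.
rewrite (exchange_big_dep xpredT) //=; apply: eq_bigr => k _.
rewrite mxE enum_rankK_in // /diff_coef mulr_sumr mulr_suml.
apply: eq_big => [j|j /andP[jT /eqP E]]; first by rewrite eq_sym.
rewrite -scalerAr -scalerAl -mulrA -E -face_monomialD // missedS // E.
exact: subsetUr.
Qed.

(** The augmentation is the boundary at the empty face. At any other [T] the faces [k |: T] have at
    least two elements, where the chain vanishes. *)
Lemma boundary_chain0 (u : 'rV[R]_#|basis_faces 0|) T :
  boundary (chain u) T = if T == set0 then (u *m gf_aug resolution) 0 0 else 0.
Proof.
have [-> | T0] := eqVneq T set0; last first.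
  rewrite /boundary big1 // => k kT; rewrite chain_out ?scaler0 //.
  by rewrite basis_faces0 cardsU1 kT eqSS cards_eq0.
rewrite mxE /boundary /chain; under eq_bigr do rewrite scaler_sumr.
rewrite (exchange_big_dep xpredT) //=; apply: eq_bigr => k _; rewrite mxE.
have := enum_valP k; rewrite basis_faces0 => /cards1P[j jE].
rewrite (big_pred1 j) => [|l]; last first.
  by rewrite jE setU0 inE (inj_eq set1_inj) eq_sym.
rewrite setU0 -jE /incidence_sign (_ : [set _ in _ | _] = set0) ?cards0 ?expr0 ?scale1r //.
by apply/setP => i; rewrite !inE.
Qed.

(** These are the [j] whose generator divides the monomial [a]; L_T divides it exactly when [T] lies
    in this set. *)
Definition common_tags (a : 'X_{1..#|V|}) : {set 'I_n} :=
  [set j | [forall v, (a (enum_rank v) == 0%N) ==> (j \in t v)]].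

Lemma missed_dvdP T (f : R) :
  (exists q, f = q * face_monomial K (missed T)) <->
  (forall a, a \in msupp f -> T \subset common_tags a).
Proof.
rewrite face_monomial_dvdP; split=> H a /H {}H.
  apply/subsetP => j jT; rewrite inE; apply/forallP => v; apply/implyP.
  by apply: contraTT => jv; apply: H; rewrite inE; apply: contra jv => /subsetP; apply.
move=> v; rewrite inE; apply: contra => av; apply/subsetP => j /(subsetP H).
by rewrite inE => /forallP/(_ v); rewrite av.
Qed.

(** Preferring [j0] keeps the cone inside the truncation. The default of [odflt] is reached only
    when there is no common tag. *)
Definition apex a : 'I_n :=
  if j0 \in common_tags a then j0 else odflt j0 [pick j in common_tags a].

Lemma apex_in a j : j \in common_tags a -> apex a \in common_tags a.
Proof.
by rewrite /apex; case: ifP => // _; case: pickP => //= ->.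
Qed.

(** The tag of a variable absent from [a] would contain [T], against the bound [p] on tag sizes. So
    every variable occurs in [a] and membership is vacuous. *)
Lemma common_tags_large a T j : (p < #|T|)%N -> T \subset common_tags a -> j \in common_tags a.
Proof.
move=> pT /subsetP Ta; rewrite inE; apply/forallP => v; apply/implyP => av.
have : T \subset t v by apply/subsetP => k /Ta; rewrite inE => /forallP/(_ v); rewrite av.
by move/subset_leq_card/leq_trans/(_ (t_card v)); rewrite leqNgt pT.
Qed.

(** Split [w] by the apex of the multidegree and cone each piece with its own apex. Taking pieces
    commutes with the boundary, so each piece is a cycle and, by [boundary_cone], the boundary of
    its cone. *)
Lemma basis_acyclic i w :
  (forall T, T \notin basis_faces i -> w T = 0) ->
  (forall T, exists q, w T = q * face_monomial K (missed T)) ->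
  (forall T, boundary w T = 0) ->
  exists z, [/\ (forall T, T \notin basis_faces i.+1 -> z T = 0),
    (forall T, exists q, z T = q * face_monomial K (missed T)) &
    (forall T, boundary z T = w T)].
Proof.
move=> w0 wdvd wcycle.
pose r j T := restrict_supp (fun a => apex a == j) (w T).
have rE j a T : j \in T -> (r j (T :\ j))@_a != 0 ->
    [/\ apex a = j, T :\ j \in basis_faces i & T \subset common_tags a].
  move=> jT; rewrite mcoeff_restrict_supp; case: (apex a =P j) => [aj wa | _]; last by rewrite eqxx.
  have TB : T :\ j \in basis_faces i.
    by apply: contraNT wa => /w0 ->; rewrite mcoeff0.
  have Ta : T :\ j \subset common_tags a.
    by have /missed_dvdP := wdvd (T :\ j); apply; rewrite mcoeff_msupp.
  split=> //; rewrite -(setD1K jT) subUset Ta andbT sub1set -aj.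
  (* [T :\ j] is a nonempty set of common tags, so the apex [j] is a common tag too. *)
  have /card_gt0P[k /(subsetP Ta)/apex_in //] : (0 < #|T :\ j|)%N.
  by move: TB; rewrite inE => /andP[/eqP ->].
exists (fun T => \sum_j cone j (r j) T); split=> T.
- move=> TB; apply: big1 => j _; rewrite /cone; case: ifPn => // jT.
  rewrite (_ : r j (T :\ j) = 0) ?scaler0 //; apply/mpolyP => a; rewrite mcoeff0.
  apply/eqP; apply: contraNT TB => /(rE _ _ _ jT)[aj].
  rewrite !inE (cardsD1 j T) jT add1n eqSS => /andP[/eqP cT H] Ta.
  rewrite cT eqxx /=; case: (ltnP i.+1 p) => //= pi.
  (* Now [T] has more than [p] elements, so [j0] is a common tag and hence the apex [j], which lies
     in [T]. *)
  have j0T : j0 \in T.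
    have := @common_tags_large a T j0; rewrite (cardsD1 j T) jT cT add1n.
    by rewrite ltnS => /(_ pi Ta) j0a; rewrite -aj /apex j0a in jT.
  have := @common_tags_large a T j0; rewrite (cardsD1 j T) jT cT add1n.
  rewrite ltnS => /(_ pi Ta) j0a; move: aj; rewrite /apex j0a => aj.
  (* [T :\ j0] lacks [j0], so it can only be a basis face with [i < p]; thus [i.+1 = p]. *)
  rewrite aj eqxx andbF orbF in H; by rewrite j0T andbT eqn_leq H.
- apply/missed_dvdP => a; rewrite mcoeff_msupp; apply: contraNT => Ta.
  rewrite raddf_sum /= big1 // => j _; rewrite /cone; case: ifPn => jT; last by rewrite mcoeff0.
  rewrite mcoeffZ (_ : (r j _)@_a = 0) ?mulr0 //; apply/eqP.
  by apply: contraNT Ta => /(rE _ _ _ jT)[].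
rewrite [LHS](_ : _ = \sum_j boundary (cone j (r j)) T); last first.
  rewrite /boundary exchange_big /=; apply: eq_bigr => k _.
  by rewrite -scaler_sumr.
rewrite -[RHS](restrict_supp_partition apex); apply: eq_bigr => j _.
rewrite -[RHS](boundary_cone j (r j)) /cone.
have -> : boundary (r j) (T :\ j) = restrict_supp (fun a => apex a == j) (boundary w (T :\ j)).
  by rewrite /boundary restrict_supp_sum; apply: eq_bigr => k _; rewrite restrict_suppZ.
by rewrite wcycle restrict_supp0 scaler0 if_same addr0.
Qed.

Lemma resolution_exact i (u : 'rV[R]_#|basis_faces i|) :
  (forall T, boundary (chain u) T = 0) -> exists v, u = v *m gf_diff resolution i.
Proof.
move=> u0; have [||z [z0 zd zE]] := @basis_acyclic i (chain u) _ _ u0.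
- by move=> T; apply: chain_out.
- move=> T; have [TB | TB] := boolP (T \in basis_faces i); last first.
    by exists 0; rewrite chain_out ?mul0r.
  exists (u 0 (enum_rank_in TB T)).
  by rewrite -{1}(enum_rankK_in TB TB) chain_enum_val enum_rankK_in.
have [v vE] := chain_surj z0 zd; exists v; apply: chain_inj => T.
rewrite -boundary_chain -zE /boundary; by apply: eq_bigr => k _; rewrite vE.
Qed.

Variable I : R -> Prop.
Hypothesis IE : forall f, I f <->
  exists b : 'I_n -> R, f = \sum_j b j * face_monomial K (missed [set j]).

Lemma resolution_minimal : minimal_graded_free_resolution I resolution.
Proof.
have ex0 (u : 'rV_#|basis_faces 0|) : u *m gf_aug resolution = 0 <->
    forall T, boundary (chain u) T = 0.
  split=> [E T | E]; first by rewrite boundary_chain0 E mxE if_same.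
  apply/matrixP => a b; rewrite !ord1; have := E set0.
  by rewrite boundary_chain0 eqxx => ->; rewrite mxE.
have exS i (u : 'rV_#|basis_faces i.+1|) : u *m gf_diff resolution i = 0 <->
    forall T, boundary (chain u) T = 0.
  split=> [E T | E]; first by rewrite boundary_chain E chain0.
  by apply: chain_inj => T; rewrite -boundary_chain E chain0.
have imE i (v : 'rV_#|basis_faces i.+1|) T :
    boundary (chain (v *m gf_diff resolution i)) T = 0.
  rewrite -[RHS](boundary_boundary (chain v) T).
  by apply: eq_bigr => k _; rewrite boundary_chain.
split.
- split=> [k | i k l]; first by rewrite mxE face_monomial_homog.
  rewrite mxE /diff_coef /homog_diff /=; case: leqP => H; last first.
    rewrite big1 // => j /andP[_ /eqP E]; move: H; rewrite ltnNge.
    by rewrite subset_leq_card // missedS // -E subsetUr.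
  apply: rpred_sum => j /andP[_ /eqP E]; apply: rpredZ.
  have S : missed (enum_val l) \subset missed (enum_val k).
    by rewrite missedS // -E subsetUr.
  by have := face_monomial_homog K (missed (enum_val k) :\: missed (enum_val l));
    rewrite cardsD (setIidPr S).
- split.
  + move=> f; rewrite IE; split=> [[b ->] | [u uE]].
      have S1 j : [set j] \in basis_faces 0 by rewrite basis_faces0 cards1.
      exists (\sum_j b j *: delta_mx 0 (enum_rank_in (S1 j) [set j])).
      apply/matrixP => x y; rewrite !ord1 mulmx_suml summxE mxE eqxx mulr1n.
      apply: eq_bigr => j _; rewrite -scalemxAl -rowE mxE [row _ _ _ _]mxE mxE.
      by rewrite enum_rankK_in ?S1.
    exists (fun j => \sum_(k | enum_val k == [set j]) u 0 k).
    move/matrixP/(_ 0 0): uE; rewrite !mxE eqxx mulr1n => <-.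
    under [RHS]eq_bigr do rewrite mulr_suml.
    rewrite (exchange_big_dep xpredT) //=; apply: eq_bigr => k _; rewrite mxE.
    have := enum_valP k; rewrite basis_faces0 => /cards1P[j jE].
    by rewrite (big_pred1 j) ?jE // => l; rewrite (inj_eq set1_inj) eq_sym.
  + move=> u; rewrite ex0; split=> [/resolution_exact // | [v ->] T]; exact: imE.
  + move=> i u; rewrite exS; split=> [/resolution_exact // | [v ->] T]; exact: imE.
- move=> i k l; rewrite mxE /diff_coef raddf_sum big1 // => j /andP[jl /eqP E].
  rewrite [LHS]mcoeffZ face_monomial_mcoeff0 ?mulr0 //.
  have := enum_valP l; rewrite inE => /andP[/eqP cl _].
  have := enum_valP k; rewrite inE => /andP[_ H].
  have lp : (#|enum_val l| <= p)%N
    by rewrite cl; case/orP: H => [/ltnW //|/andP[/eqP E1 _]]; rewrite E1.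
  (* The variable of [v] divides L of the larger face but not L of its facet, so the quotient is not
     constant. *)
  have [v lv jv] := t_sep lp jl; apply/set0Pn; exists v; rewrite !inE lv /=.
  by apply: contra jv => /subsetP; apply; rewrite -E setU11.
Qed.

End Resolution.

Lemma exists_set_between (T : finType) (A B : {set T}) k :
  A \subset B -> #|A| <= k <= #|B| -> exists S : {set T}, [/\ A \subset S, S \subset B & #|S| = k].
Proof.
move=> AB /andP[Ak kB].
have : 0 < #|[set U : {set T} | U \subset B :\: A & #|U| == k - #|A|]|.
  by rewrite cards_draws bin_gt0 cardsD (setIidPr AB) leq_sub2r.
case/card_gt0P => U; rewrite inE subsetD => /andP[/andP[UB UA] /eqP cU].
exists (A :|: U); split; [exact: subsetUl | by rewrite subUset AB |].
by rewrite cardsU setIC (disjoint_setI0 UA) cards0 subn0 cU subnKC.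
Qed.

Lemma subsets_setC1 (T : finType) (A : {set T}) x : (A \subset ~: [set x]) = (x \notin A).
Proof. by rewrite subsetC sub1set inE. Qed.

(** * Intersection complexes: separating tags, degrees, and generators of the dual ideal *)

Section IntersectionComplex.
Variables (n : nat) (m : n.-tuple nat).
Hypothesis m_neq0 : exists j : 'I_n, tnth m j != 0.
Hypothesis mn_eq0 : mult m n = 0.
Local Notation p := (last_nonzero m).
Local Notation V := (ivertex m).
Local Notation tag v := (tag v : {set 'I_n}).

Lemma mult_le_last k : mult m k != 0 -> 0 < k <= p.
Proof.
case: k => [|k] //= mk; rewrite /last_nonzero.
have kn : k < n by rewrite ltnNge; apply: contra mk => nk; rewrite /mult /= nth_default ?size_tuple.
by apply: (@leq_bigmax_seq _ _ _ id); rewrite // mem_index_iota.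
Qed.

Lemma mult_last : mult m p != 0.
Proof.
have [j mj] := m_neq0.
have p0 : 0 < p.
  have : mult m j.+1 != 0 by rewrite /mult /= -tnth_nth.
  by move/mult_le_last/andP=> [_]; apply: leq_trans.
have : (p == 0) || (mult m p != 0).
  rewrite /last_nonzero; elim/big_ind: _ => // [x y Px Py|i ->]; last by rewrite orbT.
  by rewrite /maxn; case: ifP.
by rewrite eqn0Ngt p0.
Qed.

Lemma last_gt0 : 0 < p.
Proof. by case/andP: (mult_le_last mult_last). Qed.

Lemma last_lt : p < n.
Proof.
rewrite ltn_neqAle; apply/andP; split.
  by apply: contraTneq mult_last => ->; rewrite mn_eq0.
rewrite leqNgt; apply: contra mult_last => np.
by rewrite /mult nth_default //= size_tuple.
Qed.

Lemma card_tag_le (v : V) : #|tag v| <= p.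
Proof.
have : mult m #|tag v| != 0 by case: v => S r /=; rewrite -lt0n (leq_ltn_trans _ (ltn_ord r)).
by case/mult_le_last/andP.
Qed.

(** Enlarge [T] to a set [S] of size exactly [p] avoiding [k]. There is room because [p < n], and
    [S] carries a vertex because [mult m p] is nonzero. *)
Lemma tag_separates (T : {set 'I_n}) (k : 'I_n) : #|T| <= p -> k \notin T ->
  exists2 v : V, T \subset tag v & k \notin tag v.
Proof.
move=> Tp kT; have Tk : T \subset ~: [set k] by rewrite subsets_setC1.
have [|S [TS Sk cS]] := @exists_set_between _ _ _ p Tk.
  by rewrite Tp cardsC1 card_ord -ltnS prednK ?last_lt // (leq_trans _ last_lt).
have m0 : 0 < mult m #|S| by rewrite cS lt0n mult_last.
exists (Tagged (fun S : {set 'I_n} => 'I_(mult m #|S|)) (Ordinal m0)) => //=.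
by rewrite -subsets_setC1.
Qed.

Local Notation missed := (@missed V n (fun v => tag v)).

(** The vertices not missed are counted by the number [k] of elements that their tags have outside
    [T]. Only the size of [T] enters, which is the source of purity. *)
Lemma card_missed (T : {set 'I_n}) : #|missed T| =
  #|V| - \sum_(k < n.+1) 'C(n - #|T|, k) * mult m (k + #|T|).
Proof.
have -> : missed T = ~: [set v : V | T \subset tag v] by apply/setP => v; rewrite !inE.
rewrite cardsCs setCK; congr (_ - _).
rewrite -sum1_card (eq_bigl (fun v : V => T \subset tag v)); last by move=> v; rewrite inE.
rewrite (eq_bigl (fun v : V => (T \subset tag v) && true)); last by move=> v; rewrite andbT.
rewrite -(@sig_big_dep _ _ _ _ _ (fun S : {set 'I_n} => T \subset S)
  (fun _ _ => true) (fun _ _ => 1)) /=.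
rewrite (eq_bigr (fun S : {set 'I_n} => mult m #|S|)); last first.
  by move=> S _; rewrite sum1_card card_ord.
rewrite (reindex_onto (fun U => U :|: T) (fun S => S :\: T)) /=; last first.
  by move=> S TS; rewrite setUC -{1}(setIidPr TS) setID.
rewrite (partition_big (fun U : {set 'I_n} => inord #|U| : 'I_n.+1) xpredT) //=.
apply: eq_bigr => k _.
have condE (U : {set 'I_n}) :
    (T \subset U :|: T) && ((U :|: T) :\: T == U) && (inord #|U| == k) =
    (U \in [set U : {set 'I_n} | U \subset ~: T & #|U| == k]).
  rewrite inE subsetUr setDUl setDv setU0 (sameP eqP setDidPl) disjoints_subset /=.
  by rewrite -val_eqE /= inordK // ltnS (leq_trans (max_card _)) ?card_ord.
rewrite (eq_bigl _ _ condE) (eq_bigr (fun=> mult m (k + #|T|))); last first.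
  move=> U; rewrite inE -disjoints_subset => /andP[/disjoint_setI0 UT /eqP <-].
  by rewrite cardsU UT cards0 subn0.
by rewrite sum_nat_const cards_draws cardsCs setCK card_ord.
Qed.

Definition betti_degree i :=
  #|V| - \sum_(k < n.+1) 'C(n - i.+1, k) * mult m (k + i.+1).

(** In degree [p], removing [j0] is a bijection onto the [p]-subsets of the other [n - 1]
    indices. *)
Lemma card_basis_faces (j0 : 'I_n) i :
  #|basis_faces p j0 i| = if i < p then 'C(n, i.+1) else if i == p then 'C(n.-1, p) else 0.
Proof.
case: ltngtP => [ip | pi | ->].
- rewrite -[in RHS](card_ord n) -card_draws; apply: eq_card => T.
  by rewrite !inE ip andbT.
- by apply: eq_card0 => T; rewrite !inE ltnNge (ltnW pi) (gtn_eqF pi) /= andbF.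
have <- : #|~: [set j0]| = n.-1 by rewrite cardsC1 card_ord.
rewrite -cards_draws -(@card_in_imset _ _ (fun U => j0 |: U)); last first.
  move=> U1 U2; rewrite !inE !subsets_setC1 => /andP[h1 _] /andP[h2 _] E.
  by rewrite -(setU1K h1) E setU1K.
apply: eq_card => T; rewrite !inE ltnn eqxx /=; apply/andP/imsetP => [[/eqP cT jT]|[U]].
  exists (T :\ j0); last by rewrite setD1K.
  rewrite inE subsets_setC1 setD11 /=.
  by move/eqP: cT; rewrite (cardsD1 j0) jT eqSS.
rewrite inE subsets_setC1 => /andP[jU /eqP cU] ->.
by rewrite cardsU1 jU cU setU11.
Qed.

Section Ideal.
Variable (K : fieldType).
Local Open Scope ring_scope.

(** [missed [set j]] is the complement of the facet of [j], and every set indexing a generator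
    contains such a complement, so these monomials already generate. *)
Lemma dual_ideal_generators (j0 : 'I_n) (f : {mpoly K[#|V|]}) :
  stanley_reisner_ideal (alexander_dual (intersection_complex m)) f <->
  exists b : 'I_n -> {mpoly K[#|V|]},
    f = \sum_j b j * face_monomial K (missed [set j]).
Proof.
pose P (s : {set V}) := s \notin alexander_dual (intersection_complex m).
have PE s : P s = [exists j : 'I_n, missed [set j] \subset s].
  rewrite /P !inE negbK; apply: eq_existsb => j.
  rewrite (_ : ifacet m j = ~: missed [set j]) ?setCS //.
  by apply/setP => v; rewrite !inE negbK sub1set.
split=> [[a ->] | [b ->]].
  pose g (s : {set V}) := odflt j0 [pick j : 'I_n | missed [set j] \subset s].
  have gP s : P s -> missed [set g s] \subset s.
    by rewrite PE /g; case: pickP => //= H /existsP[j]; rewrite H.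
  exists (fun j => \sum_(s | P s && (g s == j)) a s * face_monomial K (s :\: missed [set j])).
  rewrite (partition_big g xpredT) //=; apply: eq_bigr => j _.
  rewrite mulr_suml; apply: eq_bigr => s /andP[/gP Ps /eqP <-].
  by rewrite -mulrA -face_monomialD.
(* Coefficients are attached to sets here, so indices with equal facet complements are grouped. *)
exists (fun s => \sum_(j | missed [set j] == s) b j).
rewrite [RHS](eq_bigr (fun s =>
    \sum_(j | missed [set j] == s) b j * face_monomial K (missed [set j]))).
  rewrite (exchange_big_dep xpredT) //=; apply: eq_bigr => j _.
  rewrite (big_pred1 (missed [set j])) // => s; rewrite andbC [LHS]andb_idr eq_sym //=.
  by move=> /eqP ->; rewrite -/(P _) PE; apply/existsP; exists j.
by move=> s _; rewrite mulr_suml; apply: eq_bigr => j /eqP ->.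
Qed.

End Ideal.
End IntersectionComplex.

Theorem theorem5p30 (K : fieldType) (n : nat) (m : n.-tuple nat)
    (m_neq0 : exists j : 'I_n, tnth m j != 0)
    (mn_eq0 : mult m n = 0) :
  let p := last_nonzero m in
  let I := stanley_reisner_ideal (K := K)
             (alexander_dual (intersection_complex m)) in
  (exists beta : nat -> nat -> nat, is_betti_diagram I beta) /\
  forall beta : nat -> nat -> nat, is_betti_diagram I beta ->
    pure beta /\
    exists c : nat -> nat,
      (forall i d, beta i d != 0 <-> i <= p /\ d = c i) /\
      (forall i, i <= p ->
         beta i (c i) = if i < p then 'C(n, i.+1) else 'C(n.-1, p)).
Proof.
move=> p I; have [j0 _] := m_neq0.
pose F := @resolution K (ivertex m) n (fun v => tag v) p j0.
have FI : minimal_graded_free_resolution I F.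
  apply: resolution_minimal; [exact: last_gt0 | exact: card_tag_le | | ].
    exact: tag_separates.
  exact: dual_ideal_generators.
pose b i d := #|[set k : 'I_(gf_rank F i) | gf_deg k == d]|.
have bI : is_betti_diagram I b by exists F.
(* All basis elements in homological degree [i] share one degree, so the Betti number there is the
   full rank. *)
have bE i d : b i d = if d == betti_degree m i then #|basis_faces p j0 i| else 0.
  have E (k : 'I_(gf_rank F i)) : gf_deg k = betti_degree m i.
    rewrite /= card_missed; have := enum_valP k.
    by rewrite inE => /andP[/eqP -> _].
  rewrite /b; case: eqP => [-> | ne].
    by rewrite (_ : [set _ | _] = setT) ?cardsT ?card_ord //; apply/setP => k; rewrite !inE E eqxx.
  by apply/eqP; rewrite cards_eq0 -subset0; apply/subsetP => k; rewrite !inE E => /eqP/esym/ne.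
split; first by exists b.
move=> beta betaI; have betaE i d : beta i d = b i d := betti_unique betaI bI i d.
have pn := last_lt m_neq0 mn_eq0.
(* Since [p < n], the binomial coefficients are positive for [i <= p]; beyond [p] the module is
   zero. *)
have b_neq0 i d : beta i d != 0 <-> i <= p /\ d = betti_degree m i.
  rewrite betaE bE card_basis_faces; case: (eqVneq d) => [-> | ne].
    2: by split=> // -[_ E]; rewrite E eqxx in ne.
  case: (ltngtP i p) => [ip | pi | ->]; rewrite -?lt0n ?bin_gt0.
  - by rewrite (leq_trans ip (ltnW pn)).
  - by split=> // -[].
  - by rewrite -ltnS (ltn_predK pn) pn.
split=> [i d d' /b_neq0[_ ->] /b_neq0[_ ->] // |].
exists (betti_degree m); split=> // i ip.
rewrite betaE bE eqxx card_basis_faces; case: ltnP => // pi.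
by rewrite eqn_leq ip pi.
Qed.
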